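(* Let $R$ be a maximal subring of a ring $T$. Then $(R:T)_l$ and $(R:T)_r$ are prime ideals of $R$.
   Context: All rings are associative, unital with $1\neq 0$, and not necessarily commutative; subrings contain the identity of the overring. A subring $R\subsetneq T$ is a maximal subring of $T$ if there is no subring $S$ with $R\subsetneq S\subsetneq T$. For a subring $R\subseteq T$: $(R:T)_l:=\{x\in T\mid Tx\subseteq R\}$ is the largest left ideal of $T$ contained in $R$, and $(R:T)_r:=\{x\in T\mid xT\subseteq R\}$ is the largest right ideal of $T$ contained in $R$; both are two-sided ideals of $R$. *)

(* Defs.v *)
From mathcomp Require Import all_boot all_algebra.
From mathcomp Require Import boolp classical_sets.
Set Implicit Arguments.
Unset Strict Implicit.
Unset Printing Implicit Defensive.
Import GRing.Theory.
Local Open Scope ring_scope.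
Local Open Scope classical_set_scope.

Section RingDefs.
Variable T : nzRingType.
Implicit Types R S I J P : set T.

Definition subring R : Prop := GRing.subring_closed [in R].

Definition maximal_subring R : Prop :=
  [/\ subring R, R `<` setT &
      ~ exists S, [/\ subring S, R `<` S & S `<` setT]].

Definition conductor_l R : set T := [set x | forall t : T, R (t * x)].
Definition conductor_r R : set T := [set x | forall t : T, R (x * t)].

(* For a subring R, subsets of R are represented as subsets of T. *)
Definition ideal_of R I : Prop :=
  [/\ I `<=` R, GRing.zmod_closed [in I],
      (forall r x, R r -> I x -> I (r * x)) &
      (forall r x, R r -> I x -> I (x * r))].

(* The product I J of ideals: all finite sums of products a * b with a in I
   and b in J. *)
Definition ideal_mul I J : set T :=
  [set x | exists2 s : seq (T * T),
     (forall p, p \in s -> I p.1 /\ J p.2) & x = \sum_(p <- s) p.1 * p.2].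

(* Primeness in the sense of noncommutative rings, through products of ideals;
   MathComp's prime_idealr_closed is the stronger, elementwise notion
   (completely prime). *)
Definition prime_ideal_of R P : Prop :=
  [/\ ideal_of R P, P `<` R &
      forall I J, ideal_of R I -> ideal_of R J ->
        ideal_mul I J `<=` P -> I `<=` P \/ J `<=` P].

End RingDefs.

(* Main.v *)
Require Import Defs.
From mathcomp Require Import all_boot all_algebra.
From mathcomp Require Import boolp classical_sets.

(** Let [P] be the left conductor of [R] in [T], and let [I], [J] be ideals of
    [R] with [I J] contained in [P]. Since [T I] is a left ideal of [T] that is
    also stable under right multiplication by [R], the set [R + T I] is a
    subring of [T] containing [R]. If [I] is not contained in [P], that is, if
    [T I] is not contained in [R], maximality gives [T = R + T I]; hence
    [T J] is contained in [R J + T (I J)], and so in [R], which means that [J]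
    is contained in [P].

    The statement for the right conductor is the same statement in the converse
    ring of [T], where the order of the factors [I], [J] is exchanged. *)

Set Implicit Arguments.
Unset Strict Implicit.
Unset Printing Implicit Defensive.
Import GRing.Theory.
Local Open Scope ring_scope.
Local Open Scope classical_set_scope.

Section LeftConductor.
Variable T : nzRingType.
Implicit Types A B I J K R S : set T.

(** Closure predicates on [[in A]], restated with Prop-valued membership. *)
Lemma zmod_closed_setP A :
  GRing.zmod_closed [in A] <-> A 0 /\ (forall x y, A x -> A y -> A (x - y)).
Proof.
split=> [[A0 AB]|[A0 AB]].
  split=> [|x y Ax Ay]; first exact: set_mem A0.
  by apply: set_mem; apply: AB; apply: mem_set.
split=> [|x y /set_mem Ax /set_mem Ay]; apply: mem_set => //; exact: AB.
Qed.

Lemma subring_setP A : subring A <->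
  [/\ A 1, (forall x y, A x -> A y -> A (x - y)) &
      (forall x y, A x -> A y -> A (x * y))].
Proof.
split=> [[A1 AB AM]|[A1 AB AM]].
  split=> [|x y Ax Ay|x y Ax Ay]; first exact: set_mem A1.
    by apply: set_mem; apply: AB; apply: mem_set.
  by apply: set_mem; apply: AM; apply: mem_set.
split=> [|x y /set_mem Ax /set_mem Ay|x y /set_mem Ax /set_mem Ay];
  apply: mem_set => //; [exact: AB|exact: AM].
Qed.

Lemma zmod_closed_setD A : GRing.zmod_closed [in A] ->
  forall x y, A x -> A y -> A (x + y).
Proof.
move=> /zmod_closed_setP[A0 AB] x y Ax Ay.
by rewrite -[y]opprK -[- y]sub0r; apply/AB/AB.
Qed.

Lemma subring_zmod A : subring A -> GRing.zmod_closed [in A].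
Proof.
move=> /subring_setP[A1 AB _]; apply/zmod_closed_setP; split=> //.
by rewrite -(subrr 1); exact: AB.
Qed.

Lemma ideal_mul_mem A B x y : A x -> B y -> ideal_mul A B (x * y).
Proof.
move=> Ax By; exists [:: (x, y)]; last by rewrite big_seq1.
by move=> p; rewrite inE => /eqP ->.
Qed.

Lemma ideal_mulT_zmod I : GRing.zmod_closed [in ideal_mul setT I].
Proof.
apply/zmod_closed_setP; split; first by exists [::]; rewrite ?big_nil.
move=> _ _ [s hs ->] [t ht ->].
exists (s ++ [seq (- p.1, p.2) | p <- t]).
  move=> p; rewrite mem_cat => /orP[/hs//|/mapP[q /ht[_ Iq] ->]].
  by split.
rewrite big_cat big_map -sumrN; congr (_ + _).
by apply: eq_bigr => p _; rewrite mulNr.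
Qed.

Lemma ideal_mulT_mull I t x :
  ideal_mul setT I x -> ideal_mul setT I (t * x).
Proof.
move=> [s hs ->]; exists [seq (t * p.1, p.2) | p <- s].
  by move=> p /mapP[q /hs[_ Iq] ->]; split.
by rewrite big_map mulr_sumr; apply: eq_bigr => p _; rewrite mulrA.
Qed.

Lemma ideal_mulT_mulr R I r x : ideal_of R I -> R r ->
  ideal_mul setT I x -> ideal_mul setT I (x * r).
Proof.
move=> [_ _ _ IM] Rr [s hs ->]; exists [seq (p.1, p.2 * r) | p <- s].
  by move=> p /mapP[q /hs[_ Iq] ->]; split=> //; exact: IM.
by rewrite big_map mulr_suml; apply: eq_bigr => p _; rewrite mulrA.
Qed.

(** The set [R + T I], where [T I] is the left ideal of [T] generated by [I]. *)
Definition left_extension R I : set T :=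
  [set x | exists r y, [/\ R r, ideal_mul setT I y & x = r + y]].

Lemma sub_left_extension R I : R `<=` left_extension R I.
Proof.
move=> r Rr; exists r, 0; split=> //; last by rewrite addr0.
by have /zmod_closed_setP[] := ideal_mulT_zmod I.
Qed.

Lemma mul_left_extension R I t x : subring R -> I x ->
  left_extension R I (t * x).
Proof.
move=> /subring_zmod/zmod_closed_setP[R0 _] Ix.
by exists 0, (t * x); split=> //; [exact: ideal_mul_mem|rewrite add0r].
Qed.

(** In the product [(r + y) (s + z)], the terms [y s] and [(r + y) z] lie in
    [T I]: the former because [I] is stable under right multiplication by [R],
    the latter because [T I] is a left ideal of [T]. *)
Lemma left_extension_subring R I : subring R -> ideal_of R I ->
  subring (left_extension R I).
Proof.
move=> /subring_setP[R1 RB RM] hI.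
have hTI := ideal_mulT_zmod I; have /zmod_closed_setP[_ TIB] := hTI.
apply/subring_setP; split; first exact: sub_left_extension.
  move=> _ _ [r [y [Rr Iy ->]]] [s [z [Rs Iz ->]]].
  exists (r - s), (y - z); split; [exact: RB|exact: TIB|].
  by rewrite opprD addrACA.
move=> _ _ [r [y [Rr Iy ->]]] [s [z [Rs Iz ->]]].
exists (r * s), (y * s + (r + y) * z); split; first exact: RM.
  apply: (zmod_closed_setD hTI); last exact: ideal_mulT_mull.
  exact: ideal_mulT_mulr hI Rs Iy.
by rewrite mulrDr mulrDl addrA.
Qed.

Lemma left_extension_full R I : maximal_subring R -> ideal_of R I ->
  ~ I `<=` conductor_l R -> left_extension R I = setT.
Proof.
move=> [hR _ Rmax] hI nIP; apply: contrapT => nT; apply: Rmax.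
exists (left_extension R I); split; first exact: left_extension_subring.
  split; first exact: sub_left_extension.
  by move=> ER; apply: nIP => x Ix t; apply/ER/mul_left_extension.
by split=> // TE; apply: nT; apply/seteqP.
Qed.

Lemma conductor_l_ideal R : subring R -> ideal_of R (conductor_l R).
Proof.
move=> hR; have /zmod_closed_setP[R0 _] := subring_zmod hR.
have /subring_setP[_ RB RM] := hR.
split.
- by move=> x /(_ 1); rewrite mul1r.
- apply/zmod_closed_setP; split=> [t|x y Px Py t]; first by rewrite mulr0.
  by rewrite mulrBr; exact: RB.
- by move=> r x _ Px t; rewrite mulrA; exact: Px.
- by move=> r x Rr Px t; rewrite mulrA; apply: RM => //; exact: Px.
Qed.

Lemma conductor_l_prime R : maximal_subring R ->
  prime_ideal_of R (conductor_l R).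
Proof.
move=> hRmax; have [hR [_ RnT] _] := hRmax.
have /subring_setP[R1 _ _] := hR.
have hRz := subring_zmod hR; have /zmod_closed_setP[R0 _] := hRz.
have hP := conductor_l_ideal hR; have [PR _ _ _] := hP.
split=> //.
  split=> // RP; apply: RnT => t _.
  by have := RP 1 R1 t; rewrite mulr1.
move=> I J hI [JR _ JM _] IJP.
have [IP|nIP] := pselect (I `<=` conductor_l R); [by left|right=> x Jx t].
have : left_extension R I t by rewrite (left_extension_full hRmax hI nIP).
move=> [r [y [Rr Iy ->]]]; rewrite mulrDl.
apply: (zmod_closed_setD hRz); first exact/JR/JM.
(* [T I x] lies in [R] for [x] in [J], because [I J] lies in the conductor. *)
have [s hs ->] := Iy; rewrite mulr_suml big_seq.
apply: (big_ind R) => // [|p /hs[_ Ip]]; first exact: zmod_closed_setD hRz.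
by rewrite -mulrA; apply: IJP; exact: ideal_mul_mem.
Qed.

End LeftConductor.

Section Converse.
Variable T : nzRingType.
Implicit Types I J R : set T.

(** The converse ring [T^c] has the carrier and the addition of [T], so subsets
    of [T] are read as subsets of [T^c] without any transport. *)
Lemma subring_converse R : @subring T R <-> @subring T^c R.
Proof.
by split=> /subring_setP[R1 RB RM]; apply/subring_setP; split=> // x y Rx Ry;
  exact: RM.
Qed.

Lemma maximal_subring_converse R :
  @maximal_subring T R -> @maximal_subring T^c R.
Proof.
move=> [hR RT Rmax]; split=> //; first exact/subring_converse.
by move=> [S [hS RS ST]]; apply: Rmax; exists S; split=> //;
  exact/subring_converse.
Qed.

Lemma ideal_of_converse R I : @ideal_of T R I <-> @ideal_of T^c R I.
Proof. by split=> -[IR hI IMl IMr]; split. Qed.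

Lemma ideal_mul_converse I J : @ideal_mul T^c J I = @ideal_mul T I J.
Proof.
apply/seteqP; split=> _ [s hs ->]; exists [seq (p.2, p.1) | p <- s].
- by move=> p /mapP[q /hs[Jq Iq] ->].
- by rewrite big_map.
- by move=> p /mapP[q /hs[Jq Iq] ->].
- by rewrite big_map.
Qed.

(** The conclusion [I `<=` P \/ J `<=` P] is symmetric in [I] and [J], so the
    reversal of products in [T^c] does not affect primeness. *)
Lemma prime_ideal_of_converse R P :
  @prime_ideal_of T^c R P -> @prime_ideal_of T R P.
Proof.
move=> [hP PR Pprime]; split=> //; first exact/ideal_of_converse.
move=> I J /ideal_of_converse hI /ideal_of_converse hJ IJP.
have JIP : @ideal_mul T^c J I `<=` P by rewrite ideal_mul_converse.
by have [] := Pprime J I hJ hI JIP; [right|left].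
Qed.

End Converse.

Theorem lemma2p1 (T : nzRingType) (R : set T) (hR : maximal_subring R) :
  prime_ideal_of R (conductor_l R) /\ prime_ideal_of R (conductor_r R).
Proof.
split; first exact: conductor_l_prime.
(* The right conductor in [T] is, by conversion, the left one in [T^c]. *)
apply: prime_ideal_of_converse.
exact: (conductor_l_prime (maximal_subring_converse hR)).
Qed.
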